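(* Let $\mathcal P$ be a link-preserving property of simplicial complexes and let $d\ge0$. If there are only finitely many (up to isomorphism) strong obstructions to $\mathcal P$ of dimension at most $d$, then there are only finitely many (up to isomorphism) obstructions to $\mathcal P$ of dimension at most $d$.
   Context: A simplicial complex is a family of subsets of a finite set closed under taking subsets, with vertex set $V(\Gamma)$; for $W\subseteq V(\Gamma)$, $\Gamma[W]$ is the subcomplex of faces contained in $W$; $\mathrm{link}_\Gamma(\tau)=\{\eta\in\Gamma:\eta\cap\tau=\emptyset,\eta\cup\tau\in\Gamma\}$. A property $\mathcal P$ is link-preserving if whenever $\Gamma$ satisfies $\mathcal P$, $\mathrm{link}_\Gamma(\tau)$ satisfies $\mathcal P$ for all $\tau\in\Gamma$. $\Gamma$ is an obstruction to $\mathcal P$ if it does not satisfy $\mathcal P$ but $\Gamma[W]$ satisfies $\mathcal P$ for all $W\subsetneq V(\Gamma)$. $\Gamma$ is a strong obstruction to $\mathcal P$ if it does not satisfy $\mathcal P$ but $\mathrm{link}_{\Gamma[W]}(\tau)$ satisfies $\mathcal P$ for every $W\subseteq V(\Gamma)$ and $\tau\in\Gamma[W]$ except $W=V(\Gamma)$, $\tau=\emptyset$. *)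

(* Defs.v *)
From HB Require Import structures.
From mathcomp Require Import all_boot all_order all_algebra.
Set Implicit Arguments.
Unset Strict Implicit.
Unset Printing Implicit Defensive.
Import Order.TTheory GRing.Theory Num.Theory.

(* The elements of the ambient finite type T need not be vertices: the
   vertices of a complex are the elements of its faces.  The empty family is
   allowed, and is distinct from the complex whose only face is set0. *)

Definition subset_closed (T : finType) (F : {set {set T}}) : bool :=
  [forall s in F, powerset s \subset F].

Record scomplex (T : finType) : Type := SComplex {
  faces :> {set {set T}};
  facesP : subset_closed faces }.

HB.instance Definition _ (T : finType) := [isSub for @faces T].

Lemma subset_closedP (T : finType) (F : {set {set T}}) :
  reflect (forall s t : {set T}, s \in F -> t \subset s -> t \in F)
          (subset_closed F).
Proof.
apply: (iffP forall_inP) => [clF s t sF ts | clF s sF].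
  by apply: (subsetP (clF s sF)); rewrite powersetE.
by apply/subsetP => t; rewrite powersetE; apply: clF.
Qed.

Definition vertices (T : finType) (G : scomplex T) : {set T} := cover G.

Fact restr_closed (T : finType) (G : scomplex T) (W : {set T}) :
  subset_closed [set s in G | s \subset W].
Proof.
apply/subset_closedP => s t; rewrite !inE => /andP[sG sW] ts.
by rewrite (subset_closedP _ (facesP G) s t sG ts) (subset_trans ts sW).
Qed.

Definition restr (T : finType) (G : scomplex T) (W : {set T}) : scomplex T :=
  SComplex (restr_closed G W).

Fact link_closed (T : finType) (G : scomplex T) (t : {set T}) :
  subset_closed [set s in G | (s :&: t == set0) && (s :|: t \in G)].
Proof.
apply/subset_closedP => s r; rewrite !inE => /and3P[sG /eqP st0 stG] rs.
have clG := subset_closedP _ (facesP G).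
rewrite (clG s r sG rs) (clG _ _ stG (setSU t rs)) andbT /=.
by rewrite -subset0 -st0 setSI.
Qed.

Definition link (T : finType) (G : scomplex T) (t : {set T}) : scomplex T :=
  SComplex (link_closed G t).

(* The empty family gets dimension -1, like the complex [set set0]. *)
Definition sc_dim (T : finType) (G : scomplex T) : int :=
  ((\max_(s in faces G) #|s|)%N%:Z - 1)%R.

(* The map is defined on vertices only, so that ambient elements which are not
   vertices play no role. *)
Definition isomorphic (T U : finType) (G : scomplex T) (D : scomplex U) : Prop :=
  exists f : {x : T | x \in vertices G} -> {y : U | y \in vertices D},
    bijective f /\
    forall s : {set {x : T | x \in vertices G}},
      ([set val x | x in s] \in faces G) = ([set val (f x) | x in s] \in faces D).

(* Invariance under isomorphism is not required. *)
Definition sc_property : Type := forall T : finType, scomplex T -> Prop.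

Definition finitely_many_up_to_iso (Q : sc_property) : Prop :=
  exists (n : nat) (U : 'I_n -> finType) (D : forall i : 'I_n, scomplex (U i)),
    forall (T : finType) (G : scomplex T), Q T G ->
      exists i : 'I_n, isomorphic G (D i).

Definition link_preserving (P : sc_property) : Prop :=
  forall (T : finType) (G : scomplex T), P T G ->
    forall t : {set T}, t \in faces G -> P T (link G t).

Definition obstruction (P : sc_property) (T : finType) (G : scomplex T) : Prop :=
  ~ P T G /\
  forall W : {set T}, W \proper vertices G -> P T (restr G W).

Definition strong_obstruction (P : sc_property) (T : finType) (G : scomplex T)
    : Prop :=
  ~ P T G /\
  forall W t : {set T}, W \subset vertices G -> t \in faces (restr G W) ->
    ~ (W = vertices G /\ t = set0) -> P T (link (restr G W) t).

(* Main.v *)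
(** Let G be an obstruction of dimension at most d and let t be a face of
    maximal size such that L = link G t fails P; it exists because
    link G set0 = G.  For a face s of L[W], the link of s in L[W] is the link
    of [t :|: s] in [G[W :|: t]].  If [W :|: t] misses a vertex of G, this
    satisfies P because P is link-preserving; otherwise W is the whole vertex
    set of L, and for nonempty s the maximality of t applies.  So L is a strong
    obstruction.  Taking W = V(L) and s empty shows moreover that V(L) and t
    cover V(G), so G has at most d + 1 vertices more than L: the number of
    vertices of G is bounded. *)

Require Import Defs.
From mathcomp Require Import all_boot all_order all_algebra.
From Stdlib Require Import Classical.
Import Order.TTheory GRing.Theory Num.Theory.

Set Implicit Arguments.
Unset Strict Implicit.
Unset Printing Implicit Defensive.

Section Complexes.

Variable T : finType.
Implicit Types (G : scomplex T) (s t r W : {set T}).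

Lemma face_sub G s t : s \in faces G -> t \subset s -> t \in faces G.
Proof. exact: (subset_closedP _ (facesP G)). Qed.

Lemma scomplex_eqP (G H : scomplex T) : faces G =i faces H -> G = H.
Proof. by move=> eqGH; apply: val_inj; apply/setP. Qed.

Lemma face_vertices G s : s \in faces G -> s \subset vertices G.
Proof. by move=> sG; apply: bigcup_sup. Qed.

Lemma vertex_face G x : (x \in vertices G) = ([set x] \in faces G).
Proof.
apply/bigcupP/idP => [[s sG xs] | xG]; last by exists [set x]; rewrite ?set11.
by apply: face_sub sG _; rewrite sub1set.
Qed.

Lemma in_link G t r :
  (r \in faces (link G t)) =
    [&& r \in faces G, r :&: t == set0 & r :|: t \in faces G].
Proof. by rewrite inE. Qed.

Lemma in_restr G W r :
  (r \in faces (restr G W)) = (r \in faces G) && (r \subset W).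
Proof. by rewrite inE. Qed.

Lemma link_set0 G : link G set0 = G.
Proof.
by apply: scomplex_eqP => r; rewrite in_link setI0 setU0 eqxx andbb.
Qed.

Lemma restr_vertices G : restr G (vertices G) = G.
Proof.
apply: scomplex_eqP => r; rewrite in_restr.
by case rG: (r \in _) => //=; apply: face_vertices.
Qed.

Lemma link_link_restr G W s t : s \in faces (restr (link G t) W) ->
  link (restr (link G t) W) s = link (restr G (W :|: t)) (t :|: s).
Proof.
rewrite in_restr in_link => /andP[/and3P[sG st0 stG] sW].
apply: scomplex_eqP => r.
rewrite !in_link !in_restr !in_link setIUr setIUl !setU_eq0 !subUset sW st0.
rewrite subsetUr (subset_trans sW (subsetUl W t)) !andbT.
rewrite [t :|: s]setUC setUA.
case rstG: (r :|: s :|: t \in _); last by rewrite !andbF.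
have rsG := face_sub rstG (subsetUl (r :|: s) t).
rewrite rsG (face_sub rsG (subsetUl _ _)) (face_sub rstG (setSU t (subsetUl r s))) /=.
have [rt0 | _] := boolP (r :&: t == set0); last by rewrite /= !andbF.
(* Both sides require [r] to be disjoint from [t], so allowing the vertices of [t] in the
   restriction adds no new [r]. *)
suff -> : (r \subset W :|: t) = (r \subset W).
  by case: (r \subset W); rewrite ?andbF ?andbT.
apply/idP/idP => [rWt | rW]; last exact: subset_trans rW (subsetUl _ _).
rewrite -(setIidPl rWt) setIUr (eqP rt0) setU0; exact: subsetIr.
Qed.

Lemma sc_dim_leP G (d : nat) :
  reflect (forall s, s \in faces G -> #|s| <= d.+1) (sc_dim G <= d%:Z)%R.
Proof. by rewrite /sc_dim lerBlDr -PoszD lez_nat addn1; apply: bigmax_leqP. Qed.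

Lemma vertices_link_disjoint G t : [disjoint vertices (link G t) & t].
Proof.
rewrite disjoint_subset; apply/subsetP => x.
rewrite vertex_face in_link inE => /and3P[_ /eqP xt0 _].
by apply/negP => xt; move/setP/(_ x): xt0; rewrite !inE eqxx xt.
Qed.

Lemma vertices_link_sub G t : vertices (link G t) \subset vertices G.
Proof.
by apply/subsetP => x; rewrite !vertex_face in_link => /andP[].
Qed.

End Complexes.

Lemma isomorphic_card (T U : finType) (G : scomplex T) (D : scomplex U) :
  isomorphic G D -> #|vertices G| = #|vertices D|.
Proof. by case=> f [/bij_eq_card]; rewrite !card_sig. Qed.

Section Image.

Variables (T U : finType) (G : scomplex T).
Let V := {x : T | x \in vertices G}.
Variable g : V -> U.
Hypothesis g_inj : injective g.

Let image_faces : {set {set U}} :=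
  [set g @: s | s : {set V} & [set val x | x in s] \in faces G].

Let image_closed : subset_closed image_faces.
Proof.
apply/subset_closedP => _ t /imsetP[s sG ->] tgs; rewrite inE in sG.
have -> : t = g @: (s :&: g @^-1: t).
  apply/setP => y; apply/idP/imsetP => [yt | [x]]; last first.
    by rewrite !inE => /andP[_ gxt] ->.
  by have /imsetP[x xs yx] := subsetP tgs y yt; exists x; rewrite // !inE xs -yx.
by apply: imset_f; rewrite inE; apply: face_sub sG _; apply/imsetS/subsetIl.
Qed.

Let image_complex : scomplex U := SComplex image_closed.

Let in_image (s : {set V}) :
  (g @: s \in faces image_complex) = ([set val x | x in s] \in faces G).
Proof.
apply/imsetP/idP => [[r rG /(imset_inj g_inj) ->] | sG]; first by rewrite inE in rG.
by exists s; rewrite ?inE.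
Qed.

(** Only the vertices of [G] are transported, so [U] may be smaller than [T]. *)
Lemma isomorphic_image : exists D : scomplex U, isomorphic G D.
Proof.
exists image_complex.
have gV x : g x \in vertices image_complex.
  by rewrite vertex_face -imset_set1 in_image imset_set1 -vertex_face; case: x.
exists (fun x => exist _ (g x) (gV x)); split; last by move=> s; rewrite in_image.
apply: inj_card_bij => [x y [] /g_inj // |].
rewrite card_sig -(card_imset predT g_inj); apply/subset_leq_card/subsetP => y.
case/bigcupP=> r /imsetP[s _ ->] /imsetP[x _ ->]; exact: imset_f.
Qed.

End Image.

(** Every such [G] can be copied onto ['I_m], which carries finitely many subset-closed families.
    All of them are listed, whether or not they satisfy [Q]: the list only has to meet every
    isomorphism class of [Q]. *)
Lemma finitely_many_bounded (Q : sc_property) (m : nat) :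
  (forall (T : finType) (G : scomplex T), Q T G -> #|vertices G| <= m) ->
  finitely_many_up_to_iso Q.
Proof.
move=> Qm; pose C : finType := {F : {set {set 'I_m}} | subset_closed F}.
pose D (i : 'I_#|C|) := SComplex (valP (enum_val i)).
exists #|C|, (fun=> 'I_m), D.
move=> T G /Qm; rewrite -card_sig => leVm.
have [|[F clF] isoGD] := @isomorphic_image _ _ G (widen_ord leVm \o enum_rank).
  by move=> x y [] /val_inj/enum_rank_inj.
exists (enum_rank (exist _ F clF : C)).
suff -> : D (enum_rank (exist _ F clF : C)) = SComplex clF by [].
by apply: val_inj; rewrite /= enum_rankK.
Qed.

Lemma finitely_many_card (Q : sc_property) : finitely_many_up_to_iso Q ->
  exists m, forall (T : finType) (G : scomplex T), Q T G -> #|vertices G| <= m.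
Proof.
move=> [n [U [D QD]]]; exists (\max_(i < n) #|vertices (D i)|) => T G /QD[i].
by move=> /isomorphic_card ->; apply: (leq_bigmax i).
Qed.

Lemma obstruction_link_cover (P : sc_property) (T : finType) (G : scomplex T)
    (t : {set T}) :
  link_preserving P -> obstruction P G -> t \in faces G -> ~ P T (link G t) ->
  vertices G = vertices (link G t) :|: t.
Proof.
move=> linkP [_ obsG] tG nPL; set W := vertices (link G t).
apply/eqP/negPn/negP => neqV; apply: nPL.
have L0 : set0 \in faces (restr (link G t) W).
  by rewrite restr_vertices in_link set0I set0U eqxx tG (face_sub tG) ?sub0set.
(* Writing the link [L] of [t] as the link of [set0] in [L[V(L)]] exhibits it as the link of [t] in
   [G[V(L) :|: t]], a proper restriction of the obstruction [G]. *)
rewrite -[link G t]link_set0 -[link G t]restr_vertices link_link_restr //.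
rewrite setU0; apply: linkP; last by rewrite in_restr tG subsetUr.
by apply: obsG; rewrite properEneq eq_sym neqV subUset vertices_link_sub face_vertices.
Qed.

Lemma obstruction_link_strong (P : sc_property) (T : finType) (G : scomplex T)
    (t : {set T}) :
  link_preserving P -> obstruction P G -> t \in faces G -> ~ P T (link G t) ->
  (forall r, r \in faces G -> t \proper r -> P T (link G r)) ->
  strong_obstruction P (link G t).
Proof.
move=> linkP obsG tG nPL maxt; split=> // W s WV sLW nWs.
have defV := obstruction_link_cover linkP obsG tG nPL.
have := sLW; rewrite in_restr in_link => /andP[/and3P[_ st0 stG] sW].
have [eqWV | neqWV] := eqVneq W (vertices (link G t)).
  rewrite link_link_restr // eqWV -defV restr_vertices.
  apply: maxt; first by rewrite setUC.
  (* If [t :|: s] were [t], then [s], being disjoint from [t], would be empty, which is the excluded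
     pair. *)
  rewrite properEneq subsetUl andbT; apply/eqP => defts.
  by apply: nWs; split=> //; rewrite -(eqP st0) (setIidPl _) // defts subsetUr.
rewrite link_link_restr //; apply: linkP; last first.
  by rewrite in_restr setUC stG setUSS.
apply: obsG.2; rewrite defV properEneq setSU // andbT.
(* As [t] is disjoint from the vertices of its link, it cancels from both unions. *)
apply: contra neqWV => /eqP eqWt; rewrite eqEsubset WV /=.
apply/subsetP => x xV; have := subsetUl (vertices (link G t)) t.
move=> /subsetP/(_ x xV); rewrite -eqWt inE.
by rewrite (disjointFr (vertices_link_disjoint G t) xV) orbF.
Qed.

Lemma obstruction_strong_link (P : sc_property) (T : finType) (G : scomplex T) :
  link_preserving P -> obstruction P G -> set0 \in faces G ->
  exists2 t, t \in faces G &
    strong_obstruction P (link G t) /\ vertices G = vertices (link G t) :|: t.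
Proof.
move=> linkP obsG G0; apply: NNPP => no_t.
(* The maximal face is found by contradiction: without it, induction on the size of the complement,
   from large faces down to [set0], gives [P] for every link, hence for [G]. *)
suff allP k (t : {set T}) : #|~: t| <= k -> t \in faces G -> P T (link G t).
  by apply: obsG.1; rewrite -[G]link_set0; apply: (allP #|~: (set0 : {set T})|).
elim: k t => [|k IHk] t letk tG; apply: NNPP => nPL; apply: no_t; exists t => //.
all: split; last exact: (obstruction_link_cover linkP).
all: apply: obstruction_link_strong => // r rG ltr.
all: have ltC : #|~: r| < #|~: t| by rewrite proper_card // properC.
- by have := leq_trans ltC letk.
- by apply: IHk => //; rewrite -ltnS (leq_trans ltC).
Qed.

Theorem theorem4p6 (P : sc_property) (d : nat) :
  link_preserving P ->
  finitely_many_up_to_iso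
    (fun (T : finType) (G : scomplex T) =>
       strong_obstruction P G /\ (sc_dim G <= d%:Z)%R) ->
  finitely_many_up_to_iso
    (fun (T : finType) (G : scomplex T) =>
       obstruction P G /\ (sc_dim G <= d%:Z)%R).
Proof.
move=> linkP /finitely_many_card[m strong_m].
(* Here [m] bounds the vertices of the link and [d.+1] the size of the face [t]. *)
apply: (@finitely_many_bounded _ (m + d.+1)) => T G [obsG dimG].
(* The empty family has no face whose link could be taken, but it has no vertices either. *)
have [G0 | nG0] := boolP (set0 \in faces G); last first.
  suff -> : vertices G = set0 by rewrite cards0.
  apply/setP => x; rewrite vertex_face inE; apply: contraNF nG0 => xG.
  exact: face_sub xG (sub0set _).
have [t tG [strongL ->]] := obstruction_strong_link linkP obsG G0.
move/sc_dim_leP: dimG => dimG.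
rewrite (leq_trans (leq_card_setU _ _)) // leq_add ?dimG //.
apply: strong_m; split=> //; apply/sc_dim_leP => s.
by rewrite in_link => /andP[/dimG].
Qed.
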